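(* Let $x,y\in X$ satisfy $1<\partial(x,y)<k$ and write $i=\partial(x,y)$. The transition matrix from the geometric basis $\widehat{x},\widehat{y},\widehat{x\cap y},\widehat{x+y}$ of $\mathrm{Fix}(x,y)$ to the combinatorial basis $\widehat{x},\widehat{y},B_{xy},C_{xy}$ of $\mathrm{Fix}(x,y)$ is $$\begin{pmatrix}1&0&q^{2i}[k-i][n-k-i]&q[i-1]^2\\0&1&0&q^{i-1}\\0&0&-q^{2i}[n-k-i]&q^i[i-1]\\0&0&-q^i[k-i]&[i-1]\end{pmatrix}.$$ The transition matrix from the combinatorial basis to the geometric basis of $\mathrm{Fix}(x,y)$ is $$\begin{pmatrix}1&0&\frac{[k-i][n-k-1]}{q^{k-1}[n-2k]}&\frac{-[k-1][n-k-i]}{q^{k-i-1}[n-2k]}\\0&1&\frac{[k-i]}{q^{k-i+1}[i-1][n-2k]}&\frac{-[n-k-i]}{q^{k-2i+1}[i-1][n-2k]}\\0&0&\frac{-1}{q^{k+i}[n-2k]}&\frac{1}{q^k[n-2k]}\\0&0&\frac{-[k-i]}{q^k[i-1][n-2k]}&\frac{[n-k-i]}{q^{k-i}[i-1][n-2k]}\end{pmatrix}.$$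
   Context: Let $\mathbb{F}_q$ be a finite field with $q$ elements, let $n,k$ be integers with $n>2k\geq 6$, and let $V$ be an $n$-dimensional vector space over $\mathbb{F}_q$. For $m\in\mathbb{Z}$ write $[m]=(q^m-1)/(q-1)$. Let $P$ be the set of all subspaces of $V$ and $P_\ell$ the set of $\ell$-dimensional subspaces; put $X=P_k$. The Grassmann graph $\Gamma=J_q(n,k)$ has vertex set $X$, with $x,y\in X$ adjacent iff $\dim(x\cap y)=k-1$; $\partial$ is its path-length distance and $\Gamma(x)$ is the set of neighbours of $x$. Let $E$ be a (real) Euclidean space of dimension $[n]-1$ with inner product $\langle\,,\,\rangle$, and let $P_1\to E$, $s\mapsto\widehat{s}$ be a map such that: $E=\mathrm{Span}\{\widehat{s}\mid s\in P_1\}$; $\|\widehat{s}\|^2=[n]-1$ for $s\in P_1$; $\langle\widehat{s},\widehat{t}\rangle=-1$ for distinct $s,t\in P_1$; and $\sum_{s\in P_1}\widehat{s}=0$. For $u\in P$ define $\widehat{u}=\sum_{s\in P_1,\,s\subseteq u}\widehat{s}$. The group $GL(V)$ acts on $P$, and acts linearly on $E$ by the (unique) action satisfying $\sigma(\widehat{u})=\widehat{\sigma(u)}$ for all $u\in P$, $\sigma\in GL(V)$. For $u,v\in P$, $\mathrm{Stab}(u,v)$ is the subgroup of $GL(V)$ of elements $\sigma$ with $\sigma(u)=u$ and $\sigma(v)=v$, and $\mathrm{Fix}(u,v)$ is the subspace of $E$ of vectors fixed by every element of $\mathrm{Stab}(u,v)$. For $x,y\in X$ with $1<\partial(x,y)<k$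 define $\mathcal{B}_{xy}=\{z\in\Gamma(x)\mid\partial(y,z)=\partial(x,y)+1\}$, $\mathcal{C}_{xy}=\{z\in\Gamma(x)\mid\partial(y,z)=\partial(x,y)-1\}$, and $B_{xy}=\sum_{z\in\mathcal{B}_{xy}}\widehat{z}$, $C_{xy}=\sum_{z\in\mathcal{C}_{xy}}\widehat{z}$. For such $x,y$, the geometric basis of $\mathrm{Fix}(x,y)$ is $\widehat{x},\widehat{y},\widehat{x\cap y},\widehat{x+y}$ and the combinatorial basis is $\widehat{x},\widehat{y},B_{xy},C_{xy}$ (in these orders; both are bases of $\mathrm{Fix}(x,y)$). Convention: the transition matrix from a basis $(u_j)$ to a basis $(v_j)$ is the matrix $T$ with $v_j=\sum_r T_{rj}u_r$ for all $j$. *)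

(* Defs.v *)
From HB Require Import structures.
From mathcomp Require Import all_boot all_order all_algebra.
From mathcomp Require Import reals.

Set Implicit Arguments.
Unset Strict Implicit.
Unset Printing Implicit Defensive.

Import Order.TTheory GRing.Theory Num.Theory.
Local Open Scope ring_scope.

(* Over a finite field, subspaces and linear maps are encoded by matrices over
   that field, hence form finite types. *)
Section FiniteInstances.
Import VectorInternalTheory.
Variables (F : finFieldType) (V W : vectType F).

HB.instance Definition _ : isCountable {vspace V} :=
  CanIsCountable (@vs2mxK F V).
HB.instance Definition _ : isFinite {vspace V} := CanIsFinite (@vs2mxK F V).

Lemma f2mxK : cancel (@f2mx F V W) (@Hom F V W).
Proof. by case. Qed.
HB.instance Definition _ : isCountable 'Hom(V, W) := CanIsCountable f2mxK.
HB.instance Definition _ : isFinite 'Hom(V, W) := CanIsFinite f2mxK.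
End FiniteInstances.

(* [m] = (q^m - 1)/(q - 1) for an integer m, possibly negative. *)
Definition qbr (R : fieldType) (q : R) (m : int) : R := (q ^ m - 1) / (q - 1).

Definition has_walk (T : finType) (e : rel T) (x y : T) (d : nat) : bool :=
  [exists p : d.-tuple T, path e x p && (last x p == y)].

(* The least length of an e-path from x to y; since a shortest path has fewer
   than #|T| edges, the value is #|T| when there is no path. *)
Definition graph_dist (T : finType) (e : rel T) (x y : T) : nat :=
  find (has_walk e x y) (iota 0 #|T|).

Definition subspaces (F : finFieldType) (V : vectType F) (l : nat) : predArgType :=
  {u : {vspace V} | \dim u == l}.
HB.instance Definition _ (F : finFieldType) (V : vectType F) (l : nat) :=
  SubFinite.on (subspaces V l).

Section Grassmann.
Variables (F : finFieldType) (V : vectType F) (k : nat).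
Implicit Types x y z : subspaces V k.

Definition grassmann_adj : rel (subspaces V k) :=
  fun x y => \dim (val x :&: val y)%VS == k.-1.

Definition grassmann_dist x y : nat := graph_dist grassmann_adj x y.

Definition Bset x y : {set subspaces V k} :=
  [set z | grassmann_adj x z & grassmann_dist y z == (grassmann_dist x y).+1].

(* Stated as d(y,z) + 1 = d(x,y) to avoid truncated subtraction. *)
Definition Cset x y : {set subspaces V k} :=
  [set z | grassmann_adj x z & (grassmann_dist y z).+1 == grassmann_dist x y].

End Grassmann.

Section Stabilizer.
Variables (F : finFieldType) (V : vectType F).

Definition GL : {set 'End(V)} := [set g | lker g == 0%VS].

Definition Stab (u v : {vspace V}) : {set 'End(V)} :=
  [set g in GL | (g @: u)%VS == u & (g @: v)%VS == v].

End Stabilizer.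

Section Euclidean.
Variables (F : finFieldType) (V : vectType F).
Variables (R : realType) (E : vectType R).
Variable (h : subspaces V 1 -> E).

Definition hat (u : {vspace V}) : E :=
  \sum_(s : subspaces V 1 | (val s <= u)%VS) h s.

Definition is_hat_map (ip : {dot E for idfun}) : Prop :=
  let N : R := qbr #|F|%:R (\dim {:V})%:Z in
  [/\ (\sum_(s : subspaces V 1) <[h s]>)%VS = {:E}%VS,
      forall s, ip (h s) (h s) = N - 1,
      forall s t, s != t -> ip (h s) (h t) = -1
    & \sum_s h s = 0].

(* The values of act outside GL are irrelevant.  Since the vectors hat u span E,
   the last condition determines act on GL. *)
Definition is_GL_action (act : 'End(V) -> 'End(E)) : Prop :=
  [/\ act \1%VF = \1%VF,
      {in GL V &, forall g g', act (g \o g')%VF = (act g \o act g')%VF}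
    & {in GL V, forall g u, act g (hat u) = hat (g @: u)%VS}].

Definition Fix (act : 'End(V) -> 'End(E)) (u v : {vspace V}) : {vspace E} :=
  (\bigcap_(g in Stab u v) fixedSpace (act g))%VS.

Variables (k : nat) (x y : subspaces V k).

Definition Bvec : E := \sum_(z in Bset x y) hat (val z).
Definition Cvec : E := \sum_(z in Cset x y) hat (val z).

Definition geometric_basis : 4.-tuple E :=
  [tuple hat (val x); hat (val y); hat (val x :&: val y); hat (val x + val y)].

Definition combinatorial_basis : 4.-tuple E :=
  [tuple hat (val x); hat (val y); Bvec; Cvec].

End Euclidean.

(* T is the transition matrix from the basis u of W to the basis v of W;
   the vectors of v are expressed by the columns of T. *)
Definition is_transition_matrix (R : fieldType) (E : vectType R)
    (W : {vspace E}) (m : nat) (u v : m.-tuple E) (T : 'M[R]_m) : Prop :=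
  [/\ basis_of W u, basis_of W v
    & forall j, tnth v j = \sum_r T r j *: tnth u r].

Definition mx_of_rows (R : nmodType) (m : nat) (s : seq (seq R)) : 'M[R]_m :=
  \matrix_(r, c) (nth [::] s r)`_c.

Section Matrices.
Variables (R : fieldType) (q : R) (n k i : int).
Local Notation "[ m ]q" := (qbr q m) (at level 0, format "[ m ]q").

Definition geo_to_comb : 'M[R]_4 := mx_of_rows 4
  [:: [:: 1; 0; q ^ (2 * i) * [k - i]q * [n - k - i]q; q * [i - 1]q ^+ 2];
      [:: 0; 1; 0;                                     q ^ (i - 1)];
      [:: 0; 0; - q ^ (2 * i) * [n - k - i]q;          q ^ i * [i - 1]q];
      [:: 0; 0; - q ^ i * [k - i]q;                    [i - 1]q]].

Definition comb_to_geo : 'M[R]_4 := mx_of_rows 4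
  [:: [:: 1; 0; [k - i]q * [n - k - 1]q / (q ^ (k - 1) * [n - 2 * k]q);
                - [k - 1]q * [n - k - i]q / (q ^ (k - i - 1) * [n - 2 * k]q)];
      [:: 0; 1; [k - i]q / (q ^ (k - i + 1) * [i - 1]q * [n - 2 * k]q);
                - [n - k - i]q / (q ^ (k - 2 * i + 1) * [i - 1]q * [n - 2 * k]q)];
      [:: 0; 0; - 1 / (q ^ (k + i) * [n - 2 * k]q);
                1 / (q ^ k * [n - 2 * k]q)];
      [:: 0; 0; - [k - i]q / (q ^ k * [i - 1]q * [n - 2 * k]q);
                [n - k - i]q / (q ^ (k - i) * [i - 1]q * [n - 2 * k]q)]].

End Matrices.

(* Main.v *)
Require Import Defs.
From HB Require Import structures.
From mathcomp Require Import all_boot all_order all_algebra finfield.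
From mathcomp Require Import reals zify ring.

Set Implicit Arguments.
Unset Strict Implicit.
Unset Printing Implicit Defensive.

Import Order.TTheory GRing.Theory Num.Theory.
Local Open Scope ring_scope.

(** The proof has three independent ingredients.

    Counting.  Every sum of vectors [hat z] over a family of subspaces is a
    combination of the [h s] whose coefficient at a point [s] counts the members
    of the family through [s].  Two families are enough: the subspaces just
    above [u] inside [A], and the hyperplanes of [A] above [u].  Both have
    [dim A - dim u] members (as q-brackets), so their sums of [hat] are
    combinations of [hat u] and [hat A] ([sum_hat_covers],
    [sum_hat_hyperplanes]).  Since the distance in the Grassmann graph is
    [k - dim (x :&: y)] ([grassmann_distE]), a neighbour [z] of [x] is found by
    choosing the hyperplane [H] that it cuts on [x], then [z] above [H]:
    [z] moves away from [y] iff [H] does not contain [x :&: y] and [z] is not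
    inside [x + y], and it moves towards [y] iff [H] contains [x :&: y] and [z]
    is inside [H + y].  Summing first over [z], then over [H], gives the
    expansions [BvecE] and [CvecE] in the geometric vectors.

    Fixed vectors.  The [h s] form a tight frame: [v] is, up to a constant, the
    sum of [ip v (h s) *: h s] ([frame_hat]), and a linear relation between the
    [h s] has constant coefficients ([hatE_relation]).  The action preserves
    the inner products with points, so for a fixed [v] the function
    [s |-> ip v (h s)] is constant on the orbits of the stabilizer of [x] and
    [y].  There are five orbits on points: inside [x :&: y], in [x] only, in [y]
    only, in [x + y] outside both, and outside [x + y].  The indicators of these
    classes are combinations of those of [x], [y], [x :&: y], [x + y] and of the
    whole space, and the latter contributes the zero vector.  Hence the four
    geometric vectors span the fixed space; they are free because all five
    classes are inhabited ([fix_basisP]).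

    Matrices.  The product of the two matrices is the identity, by an identity
    of rational functions in [q], [q ^ n], [q ^ k], [q ^ i].  So the
    combinatorial vectors also form a basis and the second matrix is the
    transition matrix backwards ([transition_matrix_inverse]). *)

(** * q-brackets and counts of subspaces *)

Section Qbr.
Variables (R : numFieldType) (q : R).
Hypothesis q_gt1 : 1 < q.
Local Notation "[ m ]_q" := (qbr q m%:Z) (format "[ m ]_q").

Let q1_neq0 : q - 1 != 0. Proof. by rewrite subr_eq0 gt_eqF. Qed.

Lemma qbr0 : [0]_q = 0.
Proof. by rewrite /qbr expr0z subrr mul0r. Qed.

Lemma qbr1 : [1]_q = 1.
Proof. by rewrite /qbr expr1z divff. Qed.

Lemma qbr_gt0 m : (0 < m)%N -> 0 < [m]_q.
Proof.
move=> m_gt0; rewrite /qbr -exprnP divr_gt0 ?subr_gt0 //.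
by rewrite exprn_egt1 // -lt0n.
Qed.

End Qbr.

Lemma card_mem_vspace (F : finFieldType) (V : vectType F) (u : {vspace V}) :
  #|[pred w : finvect_type V | w \in u]| = (#|F| ^ \dim u)%N.
Proof.
(* The finite type of vectors only carries the vector space structure of [V]
   once [V] is a constructor applied to its carrier. *)
case: V u => T cT u.
by rewrite -(@card_vspace F (finvect_type (Vector.Pack cT)) cT u); apply: eq_card.
Qed.

Section Covers.
Variables (F : finFieldType) (V : vectType F).
Implicit Types (u v z A H U : {vspace V}).
Local Notation q := #|F|.

Definition covers u A : {set {vspace V}} :=
  [set z : {vspace V} | (u <= z <= A)%VS & \dim z == (\dim u).+1].

Lemma dim_add_line u (w : V) : w \notin u -> \dim (u + <[w]>)%VS = (\dim u).+1.
Proof.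
move=> wu; apply/eqP; rewrite eqn_leq; apply/andP; split.
  by rewrite (leq_trans (dimv_add_leqif _ _)) // dim_vline addnC -add1n leq_add2r leq_b1.
rewrite ltnNge; apply: contra wu => le_dim.
have /eqP -> : u == (u + <[w]>)%VS by rewrite eqEdim addvSl.
by rewrite memvE addvSr.
Qed.

Lemma coversP u A (w : V) z : (u <= A)%VS -> w \in A -> w \notin u ->
  (z \in covers u A) && (w \in z) = (z == u + <[w]>)%VS.
Proof.
move=> uA wA wu; apply/idP/eqP => [|->].
  rewrite inE => /andP[/andP[/andP[uz zA] /eqP dz] wz].
  apply/eqP; rewrite eq_sym eqEdim dz dim_add_line // leqnn andbT.
  by rewrite subv_add uz -memvE.
by rewrite inE dim_add_line // eqxx addvSl subv_add uA -!memvE wA memvE addvSr.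
Qed.

Lemma card_vdiff u z : (u <= z)%VS ->
  (\sum_(w : finvect_type V | (w \in z) && (w \notin u)) 1 = q ^ \dim z - q ^ \dim u)%N.
Proof.
move=> /subvP uz; rewrite -!card_mem_vspace sum1dep_card.
rewrite -[in RHS](cardID [pred w : finvect_type V | w \in u]
  [pred w : finvect_type V | w \in z]).
rewrite [X in (X + _ - _)%N](_ : _ = #|[pred w : finvect_type V | w \in u]|).
  by rewrite addKn; apply: eq_card => w; rewrite !inE andbC.
by apply: eq_card => w; rewrite !inE andbC; case: (boolP (w \in u)) => // /uz.
Qed.

(** Each vector of [A] outside [u] lies in exactly one subspace just above [u],
    and each such subspace [z] contains as many of them as [z] minus [u]. *)
Lemma card_covers_nat u A : (u <= A)%VS ->
  (#|covers u A| * (q ^ (\dim u).+1 - q ^ \dim u) = q ^ \dim A - q ^ \dim u)%N.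
Proof.
move=> uA; rewrite -(card_vdiff uA).
transitivity (\sum_(z in covers u A)
    \sum_(w : finvect_type V | (w \in z) && (w \notin u)) 1)%N.
  rewrite -sum_nat_const; apply: eq_bigr => z.
  by rewrite inE => /andP[/andP[uz _] /eqP <-]; rewrite card_vdiff.
rewrite (exchange_big_dep (fun w : finvect_type V => (w \in A) && (w \notin u))) /=.
  apply: eq_bigr => w /andP[wA wu]; rewrite (big_pred1 (u + <[w : V]>)%VS) // => z.
  by rewrite wu andbT coversP.
by move=> z w; rewrite inE => /andP[/andP[_ /subvP zA] _] /andP[/zA-> ->].
Qed.

Lemma card_field_gt1 (R : numFieldType) : 1 < q%:R :> R.
Proof. by rewrite ltr1n finNzRing_gt1. Qed.

Lemma card_covers (R : numFieldType) u A : (u <= A)%VS ->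
  #|covers u A|%:R = qbr (q%:R : R) (\dim A - \dim u)%N%:Z.
Proof.
move=> uA; have := congr1 (fun m => m%:R : R) (card_covers_nat uA).
have q_gt1 := card_field_gt1 R; have q1 : q%:R - 1 != 0 :> R.
  by rewrite subr_eq0 gt_eqF.
have q0 : (q%:R : R) ^+ \dim u != 0.
  by rewrite expf_neq0 // gt_eqF // (lt_trans ltr01).
have q_gt0 : (0 < q)%N by rewrite ltnW // finNzRing_gt1.
rewrite natrM !natrB ?leq_pexp2l ?dimvS // !natrX => cardE.
apply: (mulIf q0); apply: (mulIf q1).
transitivity (#|covers u A|%:R * ((q%:R : R) ^+ (\dim u).+1 - q%:R ^+ \dim u)).
  by rewrite exprS; ring.
by rewrite cardE -{1}(subnK (dimvS uA)) exprD /qbr -exprnP; field.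
Qed.

Definition hyperplanes u x : {set {vspace V}} :=
  [set H : {vspace V} | (u <= H <= x)%VS & (\dim H).+1 == \dim x].

(** Double counting of the flags [u < z <= H] with [z] just above [u], by
    induction on the codimension: with [a m] hyperplanes in codimension [m], it
    gives [a m.+1 * [m] = [m.+1] * a m].  Codimension one is separate, since the
    factor [[m]] vanishes there. *)
Lemma card_hyperplanes (R : numFieldType) u x : (u <= x)%VS ->
  #|hyperplanes u x|%:R = qbr (q%:R : R) (\dim x - \dim u)%N%:Z.
Proof.
have q_gt1 := card_field_gt1 R.
move dxu: (\dim x - \dim u)%N => m; elim: m u dxu => [|m IHm] u dxu ux.
  rewrite (_ : hyperplanes u x = set0) ?cards0 ?qbr0 //.
  apply/setP => H; rewrite !inE; apply/andP => -[/andP[/dimvS uH _] /eqP dH].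
  by lia.
have [m0|m_gt0] := posnP m.
  rewrite (_ : hyperplanes u x = [set u]) ?cards1 ?m0 ?qbr1 //.
  apply/setP => H; rewrite !inE; apply/andP/eqP => [[/andP[uH _] /eqP dH]|->].
    by apply/eqP; rewrite eq_sym eqEdim uH /=; lia.
  by rewrite subvv ux; split=> //; apply/eqP; lia.
apply: (mulIf (negbT (gt_eqF (qbr_gt0 q_gt1 m_gt0)))).
transitivity (\sum_(H in hyperplanes u x) \sum_(z in covers u H) (1 : R)).
  rewrite mulr_natl -sumr_const; apply: eq_bigr => H.
  rewrite inE => /andP[/andP[uH _] /eqP dH].
  by rewrite sumr_const card_covers //; congr (qbr _ _%:Z); lia.
rewrite (exchange_big_dep [in covers u x]) /=; last first.
  move=> H z; rewrite !inE => /andP[/andP[_ Hx] _] /andP[/andP[-> zH] ->].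
  by rewrite (subv_trans zH).
transitivity (\sum_(z in covers u x) qbr (q%:R : R) m).
  apply: eq_bigr => z; rewrite inE => /andP[/andP[uz zx] /eqP dz].
  rewrite -(IHm z) ?dz //; last by lia.
  rewrite -sumr_const; apply: eq_bigl => H; rewrite !inE dz eqxx andbT uz /=.
  case: (boolP (z <= H)%VS) => [zH|]; last by rewrite andbF.
  by rewrite (subv_trans uz zH) andbT.
by rewrite sumr_const -[LHS]mulr_natl card_covers // dxu.
Qed.

End Covers.

(** * Distance in the Grassmann graph *)

Section Distance.
Variables (F : finFieldType) (V : vectType F) (k : nat).
Implicit Types x y z : subspaces V k.

Lemma hyperplane_exists (u A : {vspace V}) : (u <= A)%VS -> (\dim u < \dim A)%N ->
  exists H, H \in hyperplanes u A.
Proof.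
move=> uA duA; have := card_hyperplanes rat uA.
have [->|[H HuA] _] := set_0Vmem (hyperplanes u A); last by exists H.
rewrite cards0 => /esym/eqP; rewrite gt_eqF // qbr_gt0 ?subn_gt0 //.
exact: card_field_gt1.
Qed.

Lemma dim_subspaces x : \dim (val x) = k.
Proof. exact/eqP/(valP x). Qed.

(** Both [z :&: y] and the hyperplane [x :&: z] lie in [z], so they meet in
    codimension at most one in [z :&: y].  This bounds path lengths below. *)
Lemma grassmann_adj_dim_cap x y z : grassmann_adj x z ->
  (\dim (val z :&: val y) <= (\dim (val x :&: val y)).+1)%N.
Proof.
rewrite /grassmann_adj => /eqP dxz.
have := dimv_sum_cap (val z :&: val y) (val x :&: val z).
have : (\dim (val z :&: val y + val x :&: val z) <= \dim (val z))%N.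
  by rewrite dimvS // subv_add capvSl capvSr.
have : (\dim (val z :&: val y :&: (val x :&: val z)) <= \dim (val x :&: val y))%N.
  rewrite dimvS // subv_cap (subv_trans (capvSr _ _) (capvSl _ _)) /=.
  by rewrite (subv_trans (capvSl _ _) (capvSr _ _)).
rewrite dim_subspaces dxz; lia.
Qed.

Lemma grassmann_path_size x p :
  path (@grassmann_adj F V k) x p -> (k <= \dim (val x :&: val (last x p)) + size p)%N.
Proof.
elim: p x => [|z p IHp] x; first by rewrite capvv dim_subspaces addn0.
rewrite last_cons => /andP[xz zp]; apply: leq_trans (IHp z zp) _.
by rewrite addnS -addSn leq_add2r grassmann_adj_dim_cap.
Qed.

(** Replace a direction of [x] by one of [y]: [z] is spanned by a hyperplane of
    [x] above [x :&: y] and a vector of [y] outside [x]. *)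
Lemma grassmann_step x y : val x != val y ->
  exists2 z, grassmann_adj x z
    & \dim (val z :&: val y) = (\dim (val x :&: val y)).+1.
Proof.
move=> xy.
have dcap : (\dim (val x :&: val y) < \dim (val x))%N.
  rewrite ltn_neqAle dimvS ?capvSl // andbT; apply: contra xy => /eqP dE.
  have /eqP capE : (val x :&: val y == val x)%VS by rewrite eqEdim capvSl dE /=.
  by rewrite eqEdim -{1}capE capvSr !dim_subspaces /=.
have [H] := hyperplane_exists (capvSl (val x) (val y)) dcap.
rewrite inE dim_subspaces => /andP[/andP[capH Hx] /eqP dH].
have /subvPn[b yb xb] : ~~ (val y <= val x)%VS.
  by apply: contra xy => yx; rewrite eq_sym eqEdim yx !dim_subspaces /=.
have Hb : b \notin H by apply: contra xb; apply/subvP.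
have dz : \dim (H + <[b]>)%VS == k by rewrite dim_add_line // dH.
pose z : subspaces V k := exist _ (H + <[b]>)%VS dz.
have bz : b \in val z by rewrite memvE addvSr.
have adj_xz : grassmann_adj x z.
  rewrite /grassmann_adj (_ : k.-1 = \dim H) -?dH // eqn_leq.
  apply/andP; split; last first.
    by rewrite dimvS // subv_cap Hx addvSl.
  suff: (\dim (val x :&: val z) < \dim (val z))%N.
    by rewrite dim_subspaces => lt_k; rewrite -ltnS dH.
  rewrite ltn_neqAle dimvS ?capvSr // andbT.
  apply: contra xb => /eqP dE.
  have /eqP capE : (val x :&: val z == val z)%VS by rewrite eqEdim capvSr dE /=.
  by move: bz; rewrite -capE => /memv_capP[].
exists z => //; apply/eqP; rewrite eqn_leq grassmann_adj_dim_cap //=.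
rewrite -(@dim_add_line _ _ _ b).
  by rewrite dimvS // subv_cap addvS //= subv_add capvSr -memvE.
by apply: contra xb => /memv_capP[].
Qed.

Lemma grassmann_path_exists x y : exists p,
  [/\ path (@grassmann_adj F V k) x p, last x p = y
    & size p = (k - \dim (val x :&: val y))%N].
Proof.
move dE: (k - _)%N => d; elim: d x dE => [|d IHd] x dE.
  have le_cap : (\dim (val x :&: val y) <= k)%N.
    by move: (dimvS (capvSl (val x) (val y))); rewrite dim_subspaces.
  exists [::]; split=> //=; apply/val_inj/eqP; rewrite eqEdim !dim_subspaces leqnn.
  rewrite andbT; apply/capv_idPl/eqP; rewrite eqEdim capvSl dim_subspaces.
  by rewrite -subn_eq0 dE.
have xy : val x != val y.
  by apply: contra_eqN dE => /eqP ->; rewrite capvv dim_subspaces subnn.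
have [z xz dz] := grassmann_step xy.
have [|p [zp pE sp]] := IHd z; first by rewrite dz; lia.
by exists (z :: p); rewrite /= xz zp sp.
Qed.

Lemma grassmann_distE x y : grassmann_dist x y = (k - \dim (val x :&: val y))%N.
Proof.
set d := (k - _)%N; rewrite /grassmann_dist /graph_dist.
have [p [xp py sp]] := grassmann_path_exists x y.
have walk_d : has_walk (@grassmann_adj F V k) x y d.
  by apply/existsP; exists (Tuple (introT eqP sp)); rewrite xp /= py eqxx.
have no_walk m : (m < d)%N -> ~~ has_walk (@grassmann_adj F V k) x y m.
  apply: contraL => /existsP[t /andP[/grassmann_path_size xt /eqP ty]].
  by move: xt; rewrite ty size_tuple /d; lia.
(* The search for the distance stops before the number of vertices; a loop-free
   path is shorter than that. *)
have d_lt : (d < #|{: subspaces V k}|)%N.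
  move: py; case/shortenP: xp => p' xp' up' _ py'.
  have := max_card [in x :: p']; rewrite (card_uniqP up') => sp'.
  rewrite ltnNge; apply/negP => le_d.
  case/negP: (no_walk _ (leq_trans sp' le_d)).
  by apply/existsP; exists (in_tuple p'); rewrite xp' /= py' eqxx.
apply/eqP; rewrite eqn_leq; apply/andP; split.
  rewrite leqNgt; apply/negP => /(before_find 0%N).
  by rewrite nth_iota // walk_d.
rewrite leqNgt; apply/negP => lt_d.
have has_d : has (has_walk (@grassmann_adj F V k) x y) (iota 0 #|{: subspaces V k}|).
  by apply/hasP; exists d => //; rewrite mem_iota.
have := nth_find 0%N has_d; rewrite nth_iota ?add0n; last exact: ltn_trans d_lt.
by apply/negP/no_walk.
Qed.

End Distance.

(** * Sums of hats over subspaces above or below a given one *)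

Section HatSums.
Variables (F : finFieldType) (V : vectType F) (R : realType) (E : vectType R).
Variable h : subspaces V 1 -> E.
Implicit Types (s : subspaces V 1) (u z A H : {vspace V}).
Local Notation q := (#|F|%:R : R).

Lemma point_line s : exists2 w : V, w != 0 & val s = <[w]>%VS.
Proof.
have ds := dim_subspaces s.
have w0 : vpick (val s) != 0 by rewrite vpick0 -dimv_eq0 ds.
exists (vpick (val s)) => //; apply/eqP; rewrite eq_sym eqEdim.
by rewrite -memvE memv_pick ds dim_vline w0.
Qed.

Lemma hatE u : hat h u = \sum_s ((val s <= u)%VS%:R : R) *: h s.
Proof.
rewrite /hat big_mkcond; apply: eq_bigr => s _.
by case: ifP; rewrite ?scale1r ?scale0r.
Qed.

Lemma sum_hatE (Z : {set {vspace V}}) : \sum_(z in Z) hat h z =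
  \sum_s (#|[set z in Z | (val s <= z)%VS]|%:R : R) *: h s.
Proof.
rewrite (exchange_big_dep predT) //=; apply: eq_bigr => s _.
rewrite sumr_const scaler_nat; congr (_ *+ _).
by apply: eq_card => z; rewrite inE.
Qed.

(** A point of [H] is in all members, and a point of [A] outside [H] in exactly
    one. *)
Lemma sum_hat_covers H A : (H <= A)%VS ->
  \sum_(z in covers H A) hat h z =
    qbr q (\dim A - \dim H)%N%:Z *: hat h H + (hat h A - hat h H).
Proof.
move=> HA; rewrite sum_hatE !hatE scaler_sumr -sumrB -big_split.
apply: eq_bigr => s _ /=; rewrite scalerA -scalerBl -scalerDl; congr (_ *: _).
have [w w0 ->] := point_line s; rewrite -!memvE.
have [wH|wH] := boolP (w \in H).
  rewrite (subvP HA) // subrr addr0 mulr1 -card_covers //; congr _%:R.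
  apply: eq_card => z; rewrite !inE -memvE; case: (boolP (H <= z)%VS) => //=.
  by move=> /subvP/(_ w wH) ->; rewrite andbT.
rewrite mulr0 add0r subr0; have [wA|wA] := boolP (w \in A).
  rewrite (_ : [set _ in _ | _] = [set (H + <[w]>)%VS]) ?cards1 //.
  by apply/setP => z; rewrite in_set1 -(coversP z HA wA wH) inE memvE.
rewrite (_ : [set _ in _ | _] = set0) ?cards0 //; apply/setP => z.
rewrite !inE -memvE; apply: contraNF wA => /andP[/andP[/andP[_ /subvP zA] _]].
exact: zA.
Qed.

(** A point of [u] is in all members; a point [s] of [A] outside [u] is in the
    hyperplanes above [u + s], whose codimension is one less. *)
Lemma sum_hat_hyperplanes u A m : (u <= A)%VS -> (\dim A = \dim u + m.+1)%N ->
  \sum_(H in hyperplanes u A) hat h H =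
    qbr q m.+1%:Z *: hat h u + qbr q m%:Z *: (hat h A - hat h u).
Proof.
move=> uA dA; rewrite sum_hatE !hatE -sumrB !scaler_sumr -big_split.
apply: eq_bigr => s _ /=; rewrite -scalerBl !scalerA -scalerDl; congr (_ *: _).
have [w w0 ->] := point_line s; rewrite -!memvE.
have [wu|wu] := boolP (w \in u).
  rewrite (subvP uA) // subrr mulr0 addr0 mulr1.
  have -> : m.+1 = (\dim A - \dim u)%N by rewrite dA addKn.
  rewrite -card_hyperplanes //; congr _%:R.
  apply: eq_card => z; rewrite !inE -memvE; case: (boolP (u <= z)%VS) => //=.
  by move=> /subvP/(_ w wu) ->; rewrite andbT.
rewrite mulr0 add0r subr0; have [wA|wA] := boolP (w \in A).
  have -> : m = (\dim A - \dim (u + <[w]>)%VS)%N.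
    by rewrite dim_add_line // dA addnS subSS addKn.
  rewrite mulr1 -card_hyperplanes ?subv_add ?uA -?memvE //; congr _%:R.
  by apply: eq_card => z; rewrite !inE subv_add -!andbA; do !bool_congr.
rewrite mulr0 (_ : [set _ in _ | _] = set0) ?cards0 //; apply/setP => z.
rewrite !inE -memvE; apply: contraNF wA => /andP[/andP[/andP[_ /subvP zA] _]].
exact: zA.
Qed.

End HatSums.

(** * Neighbours of x moving away from y or towards y *)

Section Neighbours.
Variables (F : finFieldType) (V : vectType F) (k : nat).
Variables (x y : subspaces V k) (i : nat).
Hypothesis dist_xy : grassmann_dist x y = i.
Hypotheses (i_gt0 : (0 < i)%N) (i_ltk : (i < k)%N).
Implicit Types (z : subspaces V k) (H : {vspace V}).
Local Notation W := (val x :&: val y)%VS.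

Lemma dim_cap_xy : \dim W = (k - i)%N.
Proof.
move: (dimvS (capvSl (val x) (val y))).
by rewrite dim_subspaces -dist_xy grassmann_distE => /subKn.
Qed.

Lemma dim_add_xy : \dim (val x + val y) = (k + i)%N.
Proof. by have := dimv_sum_cap (val x) (val y); rewrite dim_cap_xy !dim_subspaces; lia. Qed.

Lemma BsetE z : (z \in Bset x y) =
  (\dim (val z :&: val x) == k.-1) && (\dim (val z :&: val y) == (k - i).-1).
Proof.
rewrite inE /grassmann_adj !grassmann_distE capvC [(val y :&: _)%VS]capvC dim_cap_xy.
congr (_ && _); move: (dimvS (capvSr (val z) (val y))); rewrite dim_subspaces; lia.
Qed.

Lemma CsetE z : (z \in Cset x y) =
  (\dim (val z :&: val x) == k.-1) && (\dim (val z :&: val y) == (k - i).+1).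
Proof.
rewrite inE /grassmann_adj !grassmann_distE capvC [(val y :&: _)%VS]capvC dim_cap_xy.
congr (_ && _); move: (dimvS (capvSr (val z) (val y))); rewrite dim_subspaces; lia.
Qed.

(** Classifies the members of [S] by the subspace that they cut on [x], when
    [cov H] is exactly the set of those cutting [H]. *)
Lemma sum_by_trace (E : nmodType) (f : {vspace V} -> E) (S : {set subspaces V k})
    (HH : {set {vspace V}}) (cov : {vspace V} -> {set {vspace V}}) :
    (forall z, z \in S ->
      (val z :&: val x)%VS \in HH /\ val z \in cov (val z :&: val x)%VS) ->
    (forall H z, H \in HH -> val z \in cov H -> z \in S /\ (val z :&: val x)%VS = H) ->
    (forall H u, H \in HH -> u \in cov H -> \dim u = k) ->
  \sum_(z in S) f (val z) = \sum_(H in HH) \sum_(u in cov H) f u.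
Proof.
move=> S_cov cov_S cov_dim.
rewrite (partition_big (fun z => val z :&: val x)%VS [in HH]) /=; last first.
  by move=> z /S_cov[].
apply: eq_bigr => H HHH.
rewrite (reindex_omap (val : subspaces V k -> _) insub) /=; last first.
  by move=> u /(cov_dim _ _ HHH)/eqP du; rewrite insubT.
apply: eq_bigl => z; rewrite valK eqxx andbT.
apply/andP/idP => [[/S_cov[_ zcov] /eqP <-] //|/(cov_S _ _ HHH)[-> ->]].
by rewrite eqxx.
Qed.

(** If [x :&: y] were in [z], or [z] in [x + y], then [z :&: y] would have at
    least the dimension of [x :&: y]. *)
Lemma Bset_cover z : z \in Bset x y ->
  (val z :&: val x)%VS \in hyperplanes 0%VS (val x) :\: hyperplanes W (val x) /\
  val z \in covers (val z :&: val x)%VS fullv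
            :\: covers (val z :&: val x)%VS (val x + val y)%VS.
Proof.
rewrite BsetE => /andP[/eqP dzx /eqP dzy].
have dz := dim_subspaces z; have dx := dim_subspaces x; have dy := dim_subspaces y.
rewrite !inE !capvSl !capvSr sub0v subvf dzx dx dz prednK ?eqxx ?andbT; last by lia.
split.
  apply/negP; rewrite subv_cap => /andP[Wz _].
  suff : (\dim W <= \dim (val z :&: val y))%N by rewrite dim_cap_xy dzy; lia.
  by rewrite dimvS // subv_cap Wz capvSr.
rewrite andTb; apply/negP => zxy; have := dimv_sum_cap (val z) (val y).
suff : (\dim (val z + val y) <= \dim (val x + val y))%N.
  by rewrite dim_add_xy dz dy dzy; lia.
by rewrite dimvS // subv_add zxy addvSr.
Qed.

(** As [z] meets [x + y] only in [H], it meets [y] only inside [H], that is, in a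
    proper subspace of [x :&: y]. *)
Lemma cover_Bset H z :
  H \in hyperplanes 0%VS (val x) :\: hyperplanes W (val x) ->
  val z \in covers H fullv :\: covers H (val x + val y)%VS ->
  z \in Bset x y /\ (val z :&: val x)%VS = H.
Proof.
have dz := dim_subspaces z; have dx := dim_subspaces x; have dy := dim_subspaces y.
rewrite BsetE !inE sub0v subvf !andbT andTb dx dz => /andP[WH /andP[Hx /eqP dH]].
rewrite Hx dH eqxx !andbT in WH * => /andP[zxy Hz]; rewrite Hz andTb in zxy.
have capH : (val z :&: (val x + val y) = H)%VS.
  apply/eqP; rewrite eq_sym eqEdim subv_cap Hz (subv_trans Hx (addvSl _ _)) andTb.
  suff: (\dim (val z :&: (val x + val y)) < \dim (val z))%N.
    by rewrite dz => lt_k; rewrite -ltnS dH.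
  rewrite ltn_neqAle dimvS ?capvSl // andbT.
  apply: contra zxy => /eqP dE; apply/capv_idPl/eqP.
  by rewrite eqEdim capvSl dE /=.
have dHk : k.-1 = \dim H by rewrite -dH.
have capx : (val z :&: val x = H)%VS.
  apply/eqP; rewrite eqEsubv subv_cap Hz Hx andbT -capH.
  by rewrite capvS ?addvSl.
have capy : (val z :&: val y <= W)%VS.
  rewrite subv_cap capvSr andbT (subv_trans _ Hx) // -capH.
  by rewrite capvS ?addvSr.
split=> //; rewrite capx dHk eqxx andTb eqn_leq; apply/andP; split.
  rewrite -ltnS prednK ?subn_gt0 // -dim_cap_xy ltn_neqAle dimvS // andbT.
  apply: contra WH => /eqP dE; have /eqP <- : (val z :&: val y == W)%VS.
    by rewrite eqEdim capy dE /=.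
  by rewrite -capH capvS ?addvSr.
have /(@grassmann_adj_dim_cap _ _ _ _ y) : grassmann_adj z x.
  by rewrite /grassmann_adj capx dHk.
by rewrite dim_cap_xy; lia.
Qed.

(** The dimensions of [z :&: x] and [z :&: y] add up to [k + dim (x :&: y)], while
    their sum is in [z] and their intersection in [x :&: y]; this forces both
    inclusions to be equalities. *)
Lemma Cset_cover z : z \in Cset x y ->
  (val z :&: val x)%VS \in hyperplanes W (val x) /\
  val z \in covers (val z :&: val x)%VS (val z :&: val x + val y)%VS.
Proof.
rewrite CsetE => /andP[/eqP dzx /eqP dzy].
have dz := dim_subspaces z; have dx := dim_subspaces x; have dy := dim_subspaces y.
have := dimv_sum_cap (val z :&: val x) (val z :&: val y).
have sub_z : (val z :&: val x + val z :&: val y <= val z)%VS by rewrite subv_add !capvSl.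
have capW : (val z :&: val x :&: (val z :&: val y) <= W)%VS.
  by rewrite capvS ?capvSr.
have := dimvS capW; have := dimvS sub_z.
rewrite dim_cap_xy dzx dzy dz => le_sum le_cap sum_cap.
have dcap : \dim (val z :&: val x :&: (val z :&: val y))%VS = (k - i)%N by lia.
have /eqP capWE : (val z :&: val x :&: (val z :&: val y) == W)%VS.
  by rewrite eqEdim capW dim_cap_xy dcap /=.
have /eqP addE : (val z :&: val x + val z :&: val y == val z)%VS.
  by rewrite eqEdim sub_z dz; lia.
rewrite !inE dzx dz dx capvSr capvSl prednK ?eqxx ?andbT; last by lia.
split; first by rewrite -capWE capvSl.
by rewrite -{1}addE addvS ?capvSr.
Qed.

(** By the modular law, [z = H + (y :&: z)], and [(H + y) :&: x = H]. *)
Lemma cover_Cset H z : H \in hyperplanes W (val x) ->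
  val z \in covers H (H + val y)%VS -> z \in Cset x y /\ (val z :&: val x)%VS = H.
Proof.
have dz := dim_subspaces z; have dx := dim_subspaces x; have dy := dim_subspaces y.
rewrite CsetE !inE dz dx => /andP[/andP[WH Hx] /eqP dH] /andP[/andP[Hz zHy] _].
have dHk : k.-1 = \dim H by rewrite -dH.
have capx : (val z :&: val x = H)%VS.
  apply/eqP; rewrite eqEsubv subv_cap Hz Hx andbT.
  rewrite (subv_trans (capvS zHy (subvv _))) // -vspace_modl //.
  by rewrite subv_add subvv capvC.
split=> //; rewrite capx dHk eqxx andTb.
have zE : (H + (val y :&: val z) = val z)%VS.
  by rewrite vspace_modl //; apply/capv_idPr.
have capE : (H :&: (val y :&: val z) = W)%VS.
  apply/eqP; rewrite eqEsubv !subv_cap WH capvSr (subv_trans WH Hz) !andbT.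
  rewrite (subv_trans (capvSl _ _) Hx) /=.
  exact: subv_trans (capvSr _ _) (capvSl _ _).
have := dimv_sum_cap H (val y :&: val z); rewrite zE capE dim_cap_xy dz capvC.
by lia.
Qed.

End Neighbours.

(** * Expansion of the combinatorial vectors *)

Section Expansion.
Variables (F : finFieldType) (V : vectType F) (k : nat).
Variables (x y : subspaces V k) (i : nat).
Hypothesis dist_xy : grassmann_dist x y = i.
Hypotheses (i_gt0 : (0 < i)%N) (i_ltk : (i < k)%N).
Variables (R : realType) (E : vectType R) (h : subspaces V 1 -> E).
Implicit Types (z : subspaces V k) (H : {vspace V}).
Local Notation W := (val x :&: val y)%VS.
Local Notation q := (#|F|%:R : R).
Local Notation "[ m ]_q" := (qbr q m%:Z) (format "[ m ]_q").

Lemma hat0 : hat h 0%VS = 0.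
Proof.
rewrite /hat big_pred0 // => s; rewrite subv0.
by apply: contraTF isT => /eqP s0; have := dim_subspaces s; rewrite s0 dimv0.
Qed.

Lemma sumr_setD (I : finType) (A B : {set I}) (f : I -> E) : B \subset A ->
  \sum_(j in A :\: B) f j = \sum_(j in A) f j - \sum_(j in B) f j.
Proof.
move=> /setIidPr BA; apply/esym/eqP; rewrite subr_eq.
by rewrite (big_setID B) /= BA addrC.
Qed.

Lemma cap_between H : (W <= H)%VS -> (H <= val x)%VS -> (H :&: val y = W)%VS.
Proof.
move=> WH Hx; apply/eqP.
by rewrite eqEsubv !subv_cap WH !capvSr (subv_trans (capvSl _ _) Hx).
Qed.

(** Adding [y] and intersecting with [x] are inverse bijections between the
    intervals from [x :&: y] to [x] and from [y] to [x + y]. *)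
Lemma sum_hat_hyperplanes_add :
  \sum_(H in hyperplanes W (val x)) hat h (H + val y)%VS =
  \sum_(H in hyperplanes (val y) (val x + val y)%VS) hat h H.
Proof.
have dx := dim_subspaces x; have dy := dim_subspaces y.
have dW := dim_cap_xy dist_xy; have dS := dim_add_xy dist_xy i_gt0 i_ltk.
rewrite [RHS](reindex_onto (fun H => H + val y)%VS (fun H => H :&: val x)%VS); last first.
  move=> H; rewrite inE => /andP[/andP[yH Hxy] _].
  by rewrite vspace_modr //; apply/capv_idPl.
apply: eq_bigl => H; rewrite !inE dS dx.
apply/idP/idP => [/andP[/andP[WH Hx] /eqP dH]|].
  have capx : ((H + val y) :&: val x = H)%VS.
    by rewrite -vspace_modl // capvC; apply/addv_idPl.
  have capy := cap_between WH Hx.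
  rewrite addvSr addvS // capx eqxx !andbT.
  have := dimv_sum_cap H (val y); rewrite capy dW dy; lia.
case/andP => [/andP[/andP[_ _] /eqP dHy] /eqP capx].
have Hx : (H <= val x)%VS by rewrite -capx capvSr.
have WH : (W <= H)%VS by rewrite -capx capvC capvS ?addvSr.
rewrite Hx WH.
have capy := cap_between WH Hx.
have := dimv_sum_cap H (val y); rewrite capy dW dy; lia.
Qed.

Lemma BvecE : hat h fullv = 0 -> Bvec h x y =
  ([\dim {:V} - k.-1]_q - [i.+1]_q) *:
     (([k.-1]_q - [i.-1]_q) *: hat h (val x) - ([i]_q - [i.-1]_q) *: hat h W)
  - ([k]_q - [i]_q) *: hat h (val x + val y)%VS.
Proof.
move=> hatV; have dx := dim_subspaces x.
have dW := dim_cap_xy dist_xy; have dS := dim_add_xy dist_xy i_gt0 i_ltk.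
rewrite /Bvec (sum_by_trace _ (Bset_cover dist_xy i_gt0 i_ltk)
  (cover_Bset dist_xy i_gt0 i_ltk)); last first.
  move=> H u; rewrite inE => /andP[_]; rewrite inE dx => /andP[_ /eqP dH].
  by rewrite inE => /andP[_]; rewrite inE => /andP[_ /eqP ->].
(* For a given [H], the admissible [z] are all the subspaces just above [H] except
   those inside [x + y]. *)
have inner H : H \in hyperplanes 0%VS (val x) :\: hyperplanes W (val x) ->
    \sum_(u in covers H fullv :\: covers H (val x + val y)%VS) hat h u =
    ([\dim {:V} - k.-1]_q - [i.+1]_q) *: hat h H - hat h (val x + val y)%VS.
  rewrite inE => /andP[_]; rewrite inE dx => /andP[/andP[_ Hx] /eqP dH].
  have HS : (H <= val x + val y)%VS by apply: subv_trans Hx (addvSl _ _).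
  rewrite sumr_setD; last first.
    by apply/subsetP => u; rewrite !inE subvf => /andP[/andP[-> _] ->].
  rewrite !sum_hat_covers ?subvf // hatV dS.
  have -> : (k + i - \dim H = i.+1)%N by lia.
  have -> : \dim H = k.-1 by rewrite -dH.
  rewrite sub0r scalerBl; move: (hat h H) (_ *: _) (_ *: _) => c b a.
  by rewrite opprD opprB addrCA (addrA (a - c)) subrK addrA [- b + a]addrC.
rewrite (eq_bigr _ inner) sumrB -scaler_sumr sumr_const.
have sub_hyp : hyperplanes W (val x) \subset hyperplanes 0%VS (val x).
  by apply/subsetP => H; rewrite !inE sub0v => /andP[/andP[_ ->] ->].
rewrite -[hat h (val x + val y) *+ _]scaler_nat cardsD (setIidPr sub_hyp).
rewrite natrB ?subset_leq_card // !card_hyperplanes ?sub0v ?capvSl //.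
rewrite dimv0 subn0 dx dW subKn ?(ltnW i_ltk) // sumr_setD //.
rewrite (@sum_hat_hyperplanes _ _ _ _ _ 0%VS (val x) k.-1) ?sub0v //; last first.
  by rewrite dimv0 dx; lia.
rewrite (@sum_hat_hyperplanes _ _ _ _ _ W (val x) i.-1) ?capvSl //; last first.
  by rewrite dx dW; lia.
rewrite hat0 scaler0 add0r subr0 prednK; last by lia.
congr (_ *: _ - _); rewrite !scalerBl scalerBr.
by rewrite addrCA opprD addrA.
Qed.

Lemma CvecE : Cvec h x y =
  (([i]_q - 1) * [i.-1]_q) *: hat h (val x) + ([i]_q - [i.-1]_q) *: hat h (val y)
  + (([i]_q - 1) * ([i]_q - [i.-1]_q)) *: hat h W
  + [i.-1]_q *: hat h (val x + val y)%VS.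
Proof.
have dx := dim_subspaces x; have dy := dim_subspaces y.
have dW := dim_cap_xy dist_xy; have dS := dim_add_xy dist_xy i_gt0 i_ltk.
rewrite /Cvec (sum_by_trace _ (Cset_cover dist_xy i_gt0 i_ltk)
  (cover_Cset dist_xy i_gt0 i_ltk)); last first.
  move=> H u; rewrite inE dx => /andP[_ /eqP dH].
  by rewrite inE => /andP[_ /eqP ->].
have inner H : H \in hyperplanes W (val x) ->
    \sum_(u in covers H (H + val y)%VS) hat h u =
    ([i]_q - 1) *: hat h H + hat h (H + val y)%VS.
  rewrite inE dx => /andP[/andP[WH Hx] /eqP dH].
  rewrite sum_hat_covers ?addvSl // scalerBl scale1r [LHS]addrA [LHS]addrAC.
  congr (qbr _ _%:Z *: _ - _ + _).
  have capy := cap_between WH Hx.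
  have := dimv_sum_cap H (val y); rewrite capy dW dy; lia.
rewrite (eq_bigr _ inner) big_split -scaler_sumr /= sum_hat_hyperplanes_add.
rewrite (@sum_hat_hyperplanes _ _ _ _ _ W (val x) i.-1) ?capvSl //; last first.
  by rewrite dx dW; lia.
rewrite (@sum_hat_hyperplanes _ _ _ _ _ (val y) _ i.-1) ?addvSr //; last first.
  by rewrite dy dS; lia.
rewrite prednK // !scalerBr scalerDr scalerBr !scalerA mulrBr !scalerBl.
have shuffle (X Y Y' Z Z' S : E) :
    Z + (X - Z') + (Y + (S - Y')) = X + (Y - Y') + (Z - Z') + S.
  by rewrite (addrCA Z) (addrCA Y) [LHS]addrA [LHS]addrAC; congr (_ + _); apply: addrAC.
exact: shuffle.
Qed.

End Expansion.

(** * The tight frame of points and the action on it *)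

Section Frame.
Variables (F : finFieldType) (V : vectType F) (R : realType) (E : vectType R).
Variables (h : subspaces V 1 -> E) (ip : {dot E for idfun}).
Hypothesis h_hat : is_hat_map h ip.
Hypothesis dimV_gt0 : (0 < \dim {:V})%N.
Local Notation N := (qbr (#|F|%:R : R) (\dim {:V})%:Z).

Lemma ip_hat_sum (c : subspaces V 1 -> R) t :
  ip (\sum_s c s *: h s) (h t) = N * c t - \sum_s c s.
Proof.
have [_ norm_h ip_h _] := h_hat.
have -> : ip (\sum_s c s *: h s) (h t) = \sum_s c s * ip (h s) (h t).
  by rewrite linear_sumlz; apply: eq_bigr => s _; rewrite linearZl_LR.
rewrite (bigD1 t) //= [\sum_s c s](bigD1 t) //= norm_h.
rewrite (eq_bigr (fun s => - c s)) => [|s st]; last by rewrite ip_h ?mulrN1.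
by rewrite sumrN; ring.
Qed.

(** Pairing the relation with [h t] gives [N * c t = \sum_s c s] for every [t]. *)
Lemma hatE_relation (c : subspaces V 1 -> R) s t :
  \sum_s c s *: h s = 0 -> c s = c t.
Proof.
move=> c0; have N_neq0 : N != 0 by rewrite gt_eqF // qbr_gt0 // card_field_gt1.
by apply: (mulfI N_neq0); have := ip_hat_sum c s; have := ip_hat_sum c t;
   rewrite c0 !linear0l => /esym/subr0_eq -> /esym/subr0_eq ->.
Qed.

(** On [v = h s] this is [N *: h s = (N - 1) *: h s - \sum_(t | t != s) h t],
    which holds because the [h t] add up to zero; they span [E]. *)
Lemma frame_hat v : v = N^-1 *: \sum_s ip v (h s) *: h s.
Proof.
have [span_h _ _ sum_h] := h_hat.
have N_neq0 : N != 0 by rewrite gt_eqF // qbr_gt0 // card_field_gt1.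
have : v \in (\sum_(s : subspaces V 1) <[h s]>)%VS by rewrite span_h memvf.
case/memv_sumP => vs vs_line ->.
have [c cE] : exists c : subspaces V 1 -> R, forall s, vs s = c s *: h s.
  have cP s : exists c, vs s == c *: h s.
    by have /vlineP[c ->] := vs_line s isT; exists c.
  by exists (fun s => xchoose (cP s)) => s; apply/eqP/(xchooseP (cP s)).
rewrite (eq_bigr (fun s => c s *: h s)) //.
rewrite [in RHS](eq_bigr (fun t => (N * c t) *: h t - (\sum_s c s) *: h t)).
  rewrite sumrB -scaler_sumr sum_h scaler0 subr0.
  by rewrite scaler_sumr; apply: eq_bigr => s _; rewrite scalerA mulKf.
by move=> t _; rewrite ip_hat_sum scalerBl.
Qed.

Lemma hat_fullv : hat h fullv = 0.
Proof.
by have [_ _ _ <-] := h_hat; apply: eq_bigl => s; rewrite subvf.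
Qed.

Lemma hat_point s : hat h (val s) = h s.
Proof.
rewrite /hat (big_pred1 s) // => t /=; apply/idP/eqP => [ts|->]; last exact: subvv.
by apply/val_inj/eqP; rewrite eqEdim ts !dim_subspaces.
Qed.

Variable act : 'End(V) -> 'End(E).
Hypothesis h_act : is_GL_action h act.

Lemma GL_point g (s : subspaces V 1) : g \in GL V -> \dim (g @: val s) == 1%N.
Proof.
rewrite inE => /eqP g0; rewrite limg_dim_eq ?dim_subspaces //.
by rewrite g0 capv0.
Qed.

(** The action permutes the [h s], hence preserves their Gram matrix. *)
Lemma ip_act_point g v (s : subspaces V 1) : g \in GL V ->
  ip (act g v) (hat h (g @: val s)%VS) = ip v (h s).
Proof.
move=> gGL; have [_ norm_h ip_h _] := h_hat; have [_ _ actE] := h_act.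
pose gs t : subspaces V 1 := exist _ (g @: val t)%VS (GL_point t gGL).
have gs_inj : injective gs.
  move=> t t' /(congr1 val) /= gtt'; apply/val_inj/eqP.
  have g0 : lker g == 0%VS by move: (gGL); rewrite inE.
  by rewrite eqEsubv -(limg_ker0 (val t) (val t') g0) -(limg_ker0 (val t') (val t) g0)
    gtt' subvv.
have hgs t : hat h (g @: val t)%VS = h (gs t) by rewrite -hat_point.
have ip_gs t : ip (h (gs t)) (h (gs s)) = ip (h t) (h s).
  have [->|ts] := eqVneq t s; first by rewrite !norm_h.
  by rewrite !ip_h ?inj_eq.
have [c ->] : exists c : subspaces V 1 -> R, v = N^-1 *: \sum_t c t *: h t.
  by exists (fun t => ip v (h t)); apply: frame_hat.
rewrite hgs.
have -> : act g (N^-1 *: \sum_t c t *: h t) = N^-1 *: \sum_t c t *: h (gs t).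
  rewrite linearZ linear_sum; congr (_ *: _); apply: eq_bigr => t _.
  by rewrite linearZ /= -[in LHS]hat_point actE // hgs.
rewrite !linearZl_LR !linear_sumlz; congr (_ * _); apply: eq_bigr => t _.
by rewrite !linearZl_LR /= ip_gs.
Qed.

Lemma Fix_ip g u u' v (s : subspaces V 1) : v \in Fix act u u' -> g \in Stab u u' ->
  ip v (hat h (g @: val s)%VS) = ip v (h s).
Proof.
move=> vFix gStab; have gGL : g \in GL V by move: gStab; rewrite inE => /andP[].
move: vFix; rewrite memvE => /subv_bigcapP/(_ g gStab).
by rewrite -memvE => /fixedSpaceP vE; rewrite -[in LHS]vE ip_act_point.
Qed.

Lemma hat_in_Fix u u' w : {in Stab u u', forall g, (g @: w = w)%VS} ->
  hat h w \in Fix act u u'.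
Proof.
move=> gw; have [_ _ actE] := h_act; apply/subv_bigcapP => g gStab.
apply/fixedSpaceP; rewrite actE ?gw //.
by move: gStab; rewrite inE => /andP[].
Qed.

End Frame.

(** * Moving vectors by the stabilizer of two subspaces *)

Section Orbits.
Variables (F : finFieldType) (V : vectType F).
Implicit Types (U W x y : {vspace V}) (a b : V).

Lemma functional_separating W a : a \notin W ->
  exists2 f : 'Hom(V, F^o), {in W, forall w, f w = 0} & f a != 0.
Proof.
move=> aW; pose p := (\1 - projv W)%VF; pose c i : V -> F^o := coord (vbasis fullv) i.
have pa : p a != 0.
  apply: contra aW; rewrite /p add_lfunE opp_lfunE id_lfunE subr_eq0 => /eqP ->.
  exact: memv_proj.
have [i ci] : exists i, c i (p a) != 0.
  apply/existsP; apply: contraR pa => /existsPn c0.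
  rewrite (coord_vbasis (memvf (p a))) big1 // => i _.
  by have := c0 i; rewrite negbK => /eqP; rewrite /c => ->; rewrite scale0r.
exists (linfun (c i) \o p)%VF => [w wW|]; last by rewrite comp_lfunE lfunE.
rewrite comp_lfunE /p add_lfunE opp_lfunE id_lfunE projv_id // subrr.
by rewrite linear0.
Qed.

(** If neither of two functionals separating [a], respectively [b], from [W]
    works for both vectors, then their sum does. *)
Lemma functional_separating2 W a b : a \notin W -> b \notin W ->
  exists f : 'Hom(V, F^o), [/\ {in W, forall w, f w = 0}, f a != 0 & f b != 0].
Proof.
move=> /functional_separating[f fW fa] /functional_separating[g gW gb].
have [fb|fb] := eqVneq (f b) 0; last by exists f.
have [ga|ga] := eqVneq (g a) 0; last by exists g.
exists (f + g)%VF; split=> [w wW||]; rewrite add_lfunE.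
- by rewrite fW ?gW ?addr0.
- by rewrite ga addr0.
- by rewrite fb add0r.
Qed.

(** The map [v |-> v + (f v / f a) *: (b - a)] where [f] vanishes on [W] but not at
    [a] and [b].  It is injective since it multiplies the values of [f] by
    [f b / f a]. *)
Lemma exists_transvection W a b : a \notin W -> b \notin W ->
  exists2 g : 'End(V), lker g == 0%VS &
    [/\ g a = b, {in W, forall w, g w = w} & forall v, g v - v \in <[b - a]>%VS].
Proof.
move=> aW bW; have [f [fW fa fb]] := functional_separating2 aW bW.
pose t v : V := (f v / f a) *: (b - a).
have t_lin : linear t by move=> c u v; rewrite /t linearP mulrDl -mulrA scalerDl scalerA.
pose tL := GRing.isLinear.Build _ _ _ _ t t_lin.
pose tF : {linear V -> V} := HB.pack t tL.
have gE v : (\1 + linfun tF)%VF v = v + (f v / f a) *: (b - a).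
  by rewrite add_lfunE id_lfunE lfunE.
exists (\1 + linfun tF)%VF.
  rewrite -subv0; apply/subvP => v; rewrite memv_ker gE => /eqP gv.
  have : f (v + (f v / f a) *: (b - a)) = 0 by rewrite gv linear0.
  rewrite linearD linearZ linearB /= => fv.
  have /eqP : f v * f b = 0 by rewrite -[RHS](mulr0 (f a)) -fv /GRing.scale /=; field.
  rewrite mulf_eq0 (negPf fb) orbF => /eqP fv0.
  by rewrite fv0 mul0r scale0r addr0 in gv; rewrite gv mem0v.
split=> [|w wW|v]; rewrite gE.
- by rewrite divff // scale1r addrC subrK.
- by rewrite fW // mul0r scale0r addr0.
- by rewrite addrC addKr memvZ // memv_line.
Qed.

Lemma limg_stable (g : 'End(V)) U : lker g == 0%VS ->
  {in U, forall v, g v \in U} -> (g @: U)%VS = U.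
Proof.
move=> /eqP g0 gU; apply/eqP; rewrite eqEdim limg_dim_eq ?g0 ?capv0 // leqnn andbT.
by apply/subvP => _ /memv_imgP[v vU ->]; apply: gU.
Qed.

(** A map fixing [W] pointwise and moving vectors only along [b - a] stabilizes
    the subspaces of [W] and those containing [b - a]. *)
Lemma Stab_move x y W a b : a \notin W -> b \notin W ->
  (x <= W)%VS || (b - a \in x) -> (y <= W)%VS || (b - a \in y) ->
  exists2 g, g \in Stab x y & g a = b.
Proof.
move=> aW bW xW yW; have [g g0 [ga gW gv]] := exists_transvection aW bW.
exists g => //; rewrite !inE g0.
have stab U : (U <= W)%VS || (b - a \in U) -> (g @: U)%VS = U.
  move=> UW; apply: limg_stable => // v vU.
  have [/subvP UW'|baU] := orP UW; first by rewrite gW ?UW'.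
  rewrite -(subrK v (g v)) memvD //; move: (gv v); rewrite !memvE => /subv_trans->//.
by rewrite !stab ?eqxx.
Qed.

End Orbits.

(** * The fixed space of the stabilizer of two subspaces *)

Section FixBasis.
Variables (F : finFieldType) (V : vectType F) (R : realType) (E : vectType R).
Variables (h : subspaces V 1 -> E) (ip : {dot E for idfun}).
Hypothesis h_hat : is_hat_map h ip.
Variable act : 'End(V) -> 'End(E).
Hypothesis h_act : is_GL_action h act.
Variables x y : {vspace V}.
Hypotheses (cap_neq0 : (x :&: y)%VS != 0%VS) (add_proper : (x + y)%VS != fullv).
Hypotheses (xy : ~~ (x <= y)%VS) (yx : ~~ (y <= x)%VS).

Definition fix_basis : 4.-tuple E :=
  [tuple hat h x; hat h y; hat h (x :&: y)%VS; hat h (x + y)%VS].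

(** The value on points is one of the [f]'s, according to the orbit of the point
    (see [class_coefE]); it is written as a combination of indicators of subspaces
    so that the corresponding sum of points is a combination of hats. *)
Definition class_coef (f0 f1 f2 f3 f4 : R) (u : {vspace V}) : R :=
  f4 + (f3 - f4) * (u <= x + y)%VS%:R + (f1 - f3) * (u <= x)%VS%:R
  + (f2 - f3) * (u <= y)%VS%:R + (f0 - f1 - f2 + f3) * (u <= x :&: y)%VS%:R.

Lemma class_coefE f0 f1 f2 f3 f4 w : class_coef f0 f1 f2 f3 f4 <[w]>%VS =
  if w \in x then if w \in y then f0 else f1
  else if w \in y then f2 else if w \in (x + y)%VS then f3 else f4.
Proof.
rewrite /class_coef -!memvE memv_cap; have [wx|wx] := boolP (w \in x).
  by rewrite (subvP (addvSl x y)) //; case: (w \in y); rewrite /=; ring.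
have [wy|wy] := boolP (w \in y).
  by rewrite (subvP (addvSr x y)) //=; ring.
by case: (w \in (x + y)%VS); rewrite /=; ring.
Qed.

Lemma sum_class_coef f0 f1 f2 f3 f4 :
  \sum_s class_coef f0 f1 f2 f3 f4 (val s) *: h s
  = (f1 - f3) *: hat h x + (f2 - f3) *: hat h y
    + (f0 - f1 - f2 + f3) *: hat h (x :&: y)%VS + (f3 - f4) *: hat h (x + y)%VS.
Proof.
have [_ _ _ sum_h] := h_hat.
have sum_f4 : \sum_s f4 *: h s = 0 by rewrite -scaler_sumr sum_h scaler0.
rewrite !hatE !scaler_sumr -[RHS]addr0 -[X in _ = _ + X]sum_f4 -!big_split /=.
apply: eq_bigr => s _; rewrite !scalerA -!scalerDl; congr (_ *: _).
by rewrite /class_coef; ring.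
Qed.

Lemma representatives : exists w0 a b e : V,
  [/\ w0 \in (x :&: y)%VS, w0 != 0, (a \in x) && (a \notin y),
      (b \in y) && (b \notin x) & e \notin (x + y)%VS].
Proof.
have [a ax ay] := subvPn xy; have [b b_y bx] := subvPn yx.
have /subvPn[e _ eS] : ~~ (fullv <= x + y)%VS.
  by apply: contra add_proper => fS; rewrite eqEsubv subvf.
exists (vpick (x :&: y)%VS), a, b, e.
by rewrite memv_pick vpick0 ax ay b_y bx.
Qed.

Lemma notin_add a b : (a \in x) && (a \notin y) -> (b \in y) && (b \notin x) ->
  [/\ a + b \in (x + y)%VS, a + b \notin x & a + b \notin y].
Proof.
case/andP => ax ay /andP[b_y bx]; split; first exact: memv_add.
  by apply: contra bx => abx; rewrite -(addKr a b) addrC memvB.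
by apply: contra ay => aby; rewrite -(addrK b a) memvB.
Qed.

Lemma line_point (w : V) : w != 0 -> exists s : subspaces V 1, val s = <[w]>%VS.
Proof.
move=> w0; have dw : \dim <[w]> == 1%N by rewrite dim_vline w0.
by exists (exist (fun u => \dim u == 1%N) <[w]>%VS dw).
Qed.

Lemma dimV_gt0 : (0 < \dim {:V})%N.
Proof.
rewrite lt0n dimv_eq0; apply: contra add_proper => /eqP V0.
by rewrite V0 eqEsubv sub0v -V0 subvf.
Qed.

(** A relation between the four hats is a relation between points whose
    coefficients depend on the class only and vanish outside [x + y].  They are
    constant by [hatE_relation], hence all zero. *)
Lemma fix_basis_free : free fix_basis.
Proof.
have [w0 [a [b [e [w0W w0_neq0 a_xy b_yx eS]]]]] := representatives.
have [abS abx aby] := notin_add a_xy b_yx.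
apply/freeP => c; rewrite !big_ord_recl big_ord0 addr0 [X in X -> _]/=.
set c1 := c ord0; set c2 := c (lift _ _); set c3 := c (lift _ _); set c4 := c (lift _ _).
move=> c_rel.
(* The values on the classes, solved from [c1 = f1 - c4], [c2 = f2 - c4] and
   [c3 = f0 - f1 - f2 + c4]. *)
pose f1 := c1 + c4; pose f2 := c2 + c4; pose f0 := c3 + f1 + f2 - c4.
have rel : \sum_s class_coef f0 f1 f2 c4 0 (val s) *: h s = 0.
  rewrite sum_class_coef subr0 [f1 - _]addrK [f2 - _]addrK.
  have -> : f0 - f1 - f2 + c4 = c3 by rewrite /f0; ring.
  by rewrite -!addrA; apply: c_rel.
have e_neq0 : e != 0 by apply: contraNneq eS => ->; apply: mem0v.
have coef0 w : w != 0 -> class_coef f0 f1 f2 c4 0 <[w]>%VS = 0.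
  move=> /line_point[s <-]; have [t tE] := line_point e_neq0.
  have ex : e \notin x by apply: contra eS; apply/subvP/addvSl.
  have ey : e \notin y by apply: contra eS; apply/subvP/addvSr.
  rewrite (hatE_relation h_hat dimV_gt0 s t rel) tE class_coefE.
  by rewrite (negPf ex) (negPf ey) (negPf eS).
have neq0 (w : V) (U : {vspace V}) : w \notin U -> w != 0.
  by apply: contraNneq => ->; apply: mem0v.
have c4_0 : c4 = 0.
  by have := coef0 _ (neq0 _ _ abx); rewrite class_coefE (negPf abx) (negPf aby) abS.
have f1_0 : f1 = 0.
  by case/andP: a_xy => ax ay; have := coef0 _ (neq0 _ _ ay);
     rewrite class_coefE ax (negPf ay).
have f2_0 : f2 = 0.
  by case/andP: b_yx => b_y bx; have := coef0 _ (neq0 _ _ bx);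
     rewrite class_coefE b_y (negPf bx).
have f0_0 : f0 = 0.
  by case/memv_capP: w0W => w0x w0y; have := coef0 _ w0_neq0;
     rewrite class_coefE w0x w0y.
have c1_0 : c1 = 0 by rewrite -f1_0 /f1 c4_0 addr0.
have c2_0 : c2 = 0 by rewrite -f2_0 /f2 c4_0 addr0.
have c3_0 : c3 = 0 by rewrite -f0_0 /f0 f1_0 f2_0 c4_0; ring.
case=> [[|[|[|[|//]]]] j_lt].
- by rewrite -[RHS]c1_0; congr c; apply: val_inj.
- by rewrite -[RHS]c2_0; congr c; apply: val_inj.
- by rewrite -[RHS]c3_0; congr c; apply: val_inj.
- by rewrite -[RHS]c4_0; congr c; apply: val_inj.
Qed.

Lemma ip_Fix_move v a b g : v \in Fix act x y -> g \in Stab x y -> a != 0 -> g a = b ->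
  ip v (hat h <[a]>%VS) = ip v (hat h <[b]>%VS).
Proof.
move=> vFix gStab /line_point[s sE] <-.
by rewrite -limg_line -sE (Fix_ip h_hat dimV_gt0 h_act _ vFix gStab) (hat_point h s).
Qed.

(** Transitivity of the stabilizer on each of the five classes.  Only the class of
    [a + b] needs two moves. *)
Lemma Fix_class_constant v w0 a b e : v \in Fix act x y ->
    w0 \in (x :&: y)%VS -> w0 != 0 -> (a \in x) && (a \notin y) ->
    (b \in y) && (b \notin x) -> e \notin (x + y)%VS ->
  forall w : V, w != 0 -> let f u := ip v (hat h <[u]>%VS) in
  f w = if w \in x then if w \in y then f w0 else f a
    else if w \in y then f b else if w \in (x + y)%VS then f (a + b) else f e.
Proof.
move=> vFix w0W w0_neq0 a_xy b_yx eS w w_neq0 f.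
have moveE (u u' : V) (W : {vspace V}) : u \notin W -> u' \notin W ->
    (x <= W)%VS || (u' - u \in x) -> (y <= W)%VS || (u' - u \in y) -> f u = f u'.
  move=> uW u'W xW yW; have [g gStab gu] := Stab_move uW u'W xW yW.
  by apply: ip_Fix_move gStab _ gu => //; apply: contraNneq uW => ->; apply: mem0v.
have [abS abx aby] := notin_add a_xy b_yx.
have [w0x w0y] := memv_capP w0W.
case/andP: a_xy => ax ay; case/andP: b_yx => b_y bx.
have [wx|wx] := boolP (w \in x); have [wy|wy] := boolP (w \in y).
- by apply: (moveE _ _ 0%VS); rewrite ?memv0 ?memvB ?orbT //.
- by apply: (moveE _ _ y); rewrite ?subvv // memvB ?orbT.
- by apply: (moveE _ _ x); rewrite ?subvv // memvB ?orbT.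
have [/memv_addP[w1 w1x [w2 w2y wE]]|wS] := boolP (w \in (x + y)%VS); last first.
  by apply: (moveE _ _ (x + y)%VS); rewrite ?addvSl ?addvSr //.
have w1y : w1 \notin y by apply: contra wy => w1y; rewrite wE memvD.
have w2x : w2 \notin x by apply: contra wx => w2x; rewrite wE memvD.
have w1_xy : (w1 \in x) && (w1 \notin y) by rewrite w1x.
have b_yx : (b \in y) && (b \notin x) by rewrite b_y.
have [_ w1bx w1by] := notin_add w1_xy b_yx.
(* From w1 + w2 to w1 + b fixing x pointwise, then to a + b fixing y pointwise. *)
rewrite (moveE w (w1 + b) x) ?subvv //; last first.
  by rewrite wE opprD addrACA subrr add0r memvB ?orbT.
apply: (moveE _ _ y); rewrite ?subvv //.
by rewrite opprD addrACA subrr addr0 memvB ?orbT.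
Qed.

Lemma Fix_sub_span : (Fix act x y <= <<fix_basis>>)%VS.
Proof.
have [w0 [a [b [e [w0W w0_neq0 a_xy b_yx eS]]]]] := representatives.
apply/subvP => v vFix; rewrite (frame_hat h_hat dimV_gt0 v) memvZ //.
have fE := Fix_class_constant vFix w0W w0_neq0 a_xy b_yx eS.
pose f u := ip v (hat h <[u]>%VS).
rewrite (eq_bigr (fun s => class_coef (f w0) (f a) (f b) (f (a + b)) (f e) (val s)
  *: h s)); last first.
  move=> s _; have [w w_neq0 sE] := point_line s.
  by rewrite sE class_coefE -(fE w w_neq0) -sE hat_point.
by rewrite sum_class_coef !memvD // memvZ // memv_span // !inE eqxx ?orbT.
Qed.

Lemma fix_basisP : basis_of (Fix act x y) fix_basis.
Proof.
rewrite /basis_of fix_basis_free andbT eqEsubv Fix_sub_span andbT.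
have stab g : g \in Stab x y -> [/\ lker g == 0%VS, (g @: x = x)%VS & (g @: y = y)%VS].
  by rewrite !inE => /andP[g0 /andP[/eqP gx /eqP gy]].
apply/span_subvP => v; rewrite !inE.
case/or4P => /eqP ->; apply: (hat_in_Fix h_act) => g /stab[g0 gx gy] //.
  by rewrite lker0_img_cap // gx gy.
by rewrite limgD gx gy.
Qed.

End FixBasis.

(** * The two transition matrices *)

Section Transition.
Variables (R : fieldType) (E : vectType R) (W : {vspace E}) (m : nat).
Variables (u v : m.-tuple E) (T T' : 'M[R]_m).

Lemma transition_matrix_inverse : basis_of W u ->
    (forall j, tnth v j = \sum_r T r j *: tnth u r) -> T *m T' = 1%:M ->
  is_transition_matrix W u v T /\ is_transition_matrix W v u T'.
Proof.
move=> uW vE TT'.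
have uE j : tnth u j = \sum_r T' r j *: tnth v r.
  transitivity (\sum_s (T *m T') s j *: tnth u s).
    rewrite TT' (bigD1 j) //= big1 ?addr0 => [|s sj]; first by rewrite mxE eqxx scale1r.
    by rewrite mxE (negPf sj) scale0r.
  under eq_bigr => s _ do rewrite mxE scaler_suml.
  rewrite exchange_big; apply: eq_bigr => r _; rewrite vE scaler_sumr.
  by apply: eq_bigr => s _; rewrite scalerA mulrC.
suff vW : basis_of W v by split; split.
rewrite basisEdim size_tuple (size_basis uW) leqnn andbT -(span_basis uW).
apply/span_subvP => _ /tnthP[j ->]; rewrite uE; apply: memv_suml => r _.
by rewrite memvZ // memv_span // mem_tnth.
Qed.

End Transition.

Lemma exprzB (R : fieldType) (q : R) (a b : int) :
  q != 0 -> q ^ (a - b) = q ^ a / q ^ b.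
Proof. by move=> q_neq0; rewrite expfzDr // invr_expz. Qed.

Section MatrixInverse.
Variables (R : fieldType) (q : R) (n k i : int).
Hypotheses (q_neq0 : q != 0) (q_neq1 : q - 1 != 0).
(* The brackets [i - 1] and [n - 2 * k] do not vanish. *)
Hypotheses (qi_neq : q ^ i - q != 0) (qn_neq : q ^ n - q ^ k * q ^ k != 0).

Lemma geo_to_combK : geo_to_comb q n k i *m comb_to_geo q n k i = 1%:M.
Proof.
have expB a b := exprzB a b q_neq0; have expD a b := expfzDr a b q_neq0.
have twoD (a : int) : 2 * a = a + a by ring.
have qk0 : q ^ k != 0 by rewrite expfz_neq0.
have qi0 : q ^ i != 0 by rewrite expfz_neq0.
have qn0 : q ^ n != 0 by rewrite expfz_neq0.
apply/matrixP => r s; rewrite !mxE !big_ord_recl big_ord0 !mxE.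
rewrite /qbr !(twoD, expB, expD) expr1z ?exprN1.
move: (q ^ k) (q ^ i) (q ^ n) qk0 qi0 qn0 qi_neq qn_neq => a b c a0 b0 c0 bq cb.
case: r => [[|[|[|[|//]]]] r_lt]; case: s => [[|[|[|[|//]]]] s_lt] /=;
  rewrite ?mulr1n ?mulr0n; field;
  by rewrite ?mulN1r ?q_neq0 ?a0 ?b0 ?c0 ?bq ?cb ?q_neq1.
Qed.

End MatrixInverse.

Section CombinatorialVectors.
Variables (F : finFieldType) (V : vectType F) (k : nat).
Variables (x y : subspaces V k) (i : nat).
Hypothesis dist_xy : grassmann_dist x y = i.
Hypotheses (i_gt0 : (0 < i)%N) (i_ltk : (i < k)%N) (k_ltV : (k < \dim {:V})%N).
Variables (R : realType) (E : vectType R) (h : subspaces V 1 -> E).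
Hypothesis hat_fullv : hat h fullv = 0.
Local Notation q := (#|F|%:R : R).
Local Notation T := (geo_to_comb q (\dim {:V})%:Z k%:Z i%:Z).

Lemma combinatorial_basisE j : tnth (combinatorial_basis h x y) j =
  \sum_r T r j *: tnth (geometric_basis h x y) r.
Proof.
have q_gt1 : 1 < q := card_field_gt1 F R.
have q_neq0 : q != 0 by rewrite gt_eqF // (lt_trans ltr01).
have q_neq1 : q - 1 != 0 by rewrite subr_eq0 gt_eqF.
set n := \dim {:V}.
have expB a b : q ^ (a - b) = q ^ a / q ^ b := exprzB a b q_neq0.
have expD a b : q ^ (a + b) = q ^ a * q ^ b := expfzDr a b q_neq0.
have twoD (a : int) : 2 * a = a + a by ring.
have qk0 : q ^ k%:Z != 0 by rewrite expfz_neq0.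
have qi0 : q ^ i%:Z != 0 by rewrite expfz_neq0.
have qn0 : q ^ n%:Z != 0 by rewrite expfz_neq0.
have nkE : (n - k.-1)%N%:Z = n%:Z - k%:Z + 1 by lia.
have k1E : k.-1%:Z = k%:Z - 1 by lia.
have i1E : i.-1%:Z = i%:Z - 1 by lia.
have iSE : i.+1%:Z = i%:Z + 1 by lia.
rewrite !big_ord_recl big_ord0 !mxE addr0.
case: j => [[|[|[|[|//]]]] j_lt] /=; rewrite !(tnth_nth 0) /=.
- by rewrite scale1r !scale0r !addr0.
- by rewrite scale1r !scale0r !addr0 add0r.
- rewrite (BvecE dist_xy i_gt0 i_ltk hat_fullv) scale0r add0r scalerBr !scalerA.
  rewrite addrA -!scaleNr; congr (_ *: _ + _ *: _ + _ *: _);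
  rewrite /qbr ?(nkE, k1E, i1E, iSE) ?(twoD, expB, expD) ?expr1z; field;
  by rewrite ?q_neq0 ?qk0 ?qi0 ?q_neq1.
- rewrite (CvecE dist_xy i_gt0 i_ltk).
  rewrite -!addrA; congr (_ *: _ + (_ *: _ + (_ *: _ + _ *: _)));
  rewrite /qbr ?(nkE, k1E, i1E, iSE) ?(twoD, expB, expD) ?expr1z; field;
  by rewrite ?q_neq0 ?qk0 ?qi0 ?q_neq1.
Qed.

End CombinatorialVectors.

Theorem theorem11p3 (F : finFieldType) (V : vectType F) (n k : nat)
    (hn : \dim {:V} = n) (hnk : (2 * k < n)%N) (hk : (6 <= 2 * k)%N)
    (R : realType) (E : vectType R) (ip : {dot E for idfun})
    (hE : (\dim {:E})%:R = qbr (#|F|%:R : R) n%:Z - 1)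
    (h : subspaces V 1 -> E) (hh : is_hat_map h ip)
    (act : 'End(V) -> 'End(E)) (hact : is_GL_action h act)
    (x y : subspaces V k) (i : nat) (hi : grassmann_dist x y = i)
    (hi1 : (1 < i)%N) (hik : (i < k)%N) :
  is_transition_matrix (Fix act (val x) (val y))
      (geometric_basis h x y) (combinatorial_basis h x y)
      (geo_to_comb (#|F|%:R : R) n%:Z k%:Z i%:Z)
  /\ is_transition_matrix (Fix act (val x) (val y))
      (combinatorial_basis h x y) (geometric_basis h x y)
      (comb_to_geo (#|F|%:R : R) n%:Z k%:Z i%:Z).
Proof.
have kV : (k < \dim {:V})%N by rewrite hn; lia.
have hat_V : hat h fullv = 0 := hat_fullv hh.
have dW := dim_cap_xy hi.
have dS := dim_add_xy hi (ltnW hi1) hik.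
have xy (u v : subspaces V k) : \dim (val u :&: val v) = (k - i)%N ->
    ~~ (val u <= val v)%VS.
  move=> duv; apply/negP => /capv_idPl uv.
  by move: duv; rewrite uv dim_subspaces; lia.
have geo_basis : basis_of (Fix act (val x) (val y)) (geometric_basis h x y).
  apply: (fix_basisP hh hact); rewrite ?xy // ?[(val y :&: _)%VS]capvC //.
    by rewrite -dimv_eq0 dW -lt0n subn_gt0.
  by apply: contra_eqN dS => /eqP ->; rewrite hn neq_ltn; apply/orP; right; lia.
have q_gt1 : 1 < (#|F|%:R : R) := card_field_gt1 F R.
have q_neq0 : (#|F|%:R : R) != 0 by rewrite gt_eqF // (lt_trans ltr01).
apply: (transition_matrix_inverse geo_basis).
  by rewrite -hn => j; have := combinatorial_basisE hi (ltnW hi1) hik kV hat_V j.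
apply: geo_to_combK => //; first by rewrite subr_eq0 gt_eqF.
  by rewrite subr_eq0 gt_eqF // -exprnP -[X in X < _]expr1 ltr_eXn2l.
by rewrite subr_eq0 gt_eqF // -!exprnP -exprD ltr_eXn2l //; lia.
Qed.
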